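(* Let $(W,S)$ be a Coxeter system and let $S=I\sqcup J$ be a partition of $S$ such that no element of $I$ is conjugate in $W$ to an element of $J$. Let $W_I$ be the subgroup generated by $I$, let $\widetilde J=\{wsw^{-1} : w\in W_I,\ s\in J\}$ and let $\widetilde W$ be the subgroup of $W$ generated by $\widetilde J$. Then $(\widetilde W,\widetilde J)$ is a Coxeter system with Coxeter matrix $\widetilde M=(\widetilde m_{\tilde s,\tilde t})_{\tilde s,\tilde t\in\widetilde J}$ (defined in the context), and $\widetilde J=\chi(\widetilde W)$ is the canonical set of Coxeter generators of $\widetilde W$.
   Context: Let $\ell$ be the length function of $(W,S)$ and $T=\bigcup_{w\in W}wSw^{-1}$ its set of reflections. For $w\in W$ put $N(w)=\{t\in T : \ell(wt)<\ell(w)\}$; for a subgroup $W'$ of $W$ generated by elements of $T$ put $\chi(W')=\{t\in T : N(t)\cap W'=\{t\}\}$, the set of canonical Coxeter generators of $W'$. For $K\subseteq S$, $W_K$ is the subgroup generated by $K$. For $s\in S$ put $s^\perp=\{r\in S : rs=sr\}$. For $s,t\in T$, $m_{s,t}\in\mathbb Z_{\ge1}\cup\{\infty\}$ is the order of $st$; if $s\in J$ and $u\in I$ then $m_{s,u}$ is even or infinite, with the convention $\infty/2=\infty$. For $B,C\subseteq I$, let $X^I_{BC}$ denote the set of $x\in W_I$ which have minimal length in $W_BxW_C$. For $\tilde t\in\widetilde J$, let $\nu(\tilde t)$ be the unique element of $J$ conjugate to $\tilde t$ under $W_I$ (this is well defined). For $\tilde s,\tilde t\in\widetilde J$ with $s=\nu(\tilde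 s)$, $t=\nu(\tilde t)$, choose $x,y\in W_I$ with $\tilde s=xsx^{-1}$, $\tilde t=yty^{-1}$, and let $f(\tilde s,\tilde t)$ be the unique element of $X^I_{I\cap s^\perp,\,I\cap t^\perp}$ such that $x^{-1}y\in W_{I\cap s^\perp}f(\tilde s,\tilde t)W_{I\cap t^\perp}$ (it depends only on $\tilde s,\tilde t$). Define $$\widetilde m_{\tilde s,\tilde t}=\begin{cases}1&\text{if }\tilde s=\tilde t,\\ m_{s,u}/2&\text{if }s=t\text{ and }f(\tilde s,\tilde t)=u\in I,\\ \infty&\text{if }s=t\text{ and }\ell(f(\tilde s,\tilde t))\ge2,\\ m_{s,t}&\text{if }s\ne t\text{ and }f(\tilde s,\tilde t)=1,\\ \infty&\text{if }s\neq t\text{ and }f(\tilde s,\tilde t)\ne1.\end{cases}$$ *)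

(* Defs.v *)
From HB Require Import structures.
From mathcomp Require Import all_boot.
From mathcomp Require Import all_classical.

Set Implicit Arguments.
Unset Strict Implicit.
Unset Printing Implicit Defensive.

Local Open Scope classical_set_scope.
Local Open Scope group_scope.

Definition gen (W : groupType) (X : set W) : set W :=
  smallest (fun A : set W => A 1 /\ forall x y, A x -> A y -> A (x / y)) X.

(* [None] stands for infinite order. *)
Definition eorder (W : groupType) (x : W) : option nat :=
  if pselect (exists n, (0 < n)%N && (x ^+ n == 1)) is left h
  then Some (ex_minn h) else None.

(* Group presentations. A letter [(x, true)] stands for [x] and [(x, false)]
   for its inverse; [pres_eq X R] is equality in the group < X | R >, that is,
   in the free group on [X] modulo the normal closure of [R]. *)
Definition letter (W : groupType) (a : W * bool) : W :=
  if a.2 then a.1 else a.1^-1.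

Definition word_eval (W : groupType) (w : seq (W * bool)) : W :=
  \prod_(a <- w) letter a.

Inductive pres_eq (W : Type) (X : set W) (R : set (seq (W * bool))) :
    seq (W * bool) -> seq (W * bool) -> Prop :=
| pres_refl w : pres_eq X R w w
| pres_sym v w : pres_eq X R v w -> pres_eq X R w v
| pres_trans u v w : pres_eq X R u v -> pres_eq X R v w -> pres_eq X R u w
| pres_cancel u v x b : X x ->
    pres_eq X R (u ++ [:: (x, b); (x, ~~ b)] ++ v) (u ++ v)
| pres_relator u v r : R r -> pres_eq X R (u ++ r ++ v) (u ++ v).

Definition presented (W : groupType) (H X : set W)
    (R : set (seq (W * bool))) : Prop :=
  H = gen X /\
  forall w : seq (W * bool), (forall a, a \in w -> X a.1) ->
    (word_eval w = 1 <-> pres_eq X R w [::]).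

Definition coxeter_relators (W : groupType) (S : set W) :
    set (seq (W * bool)) :=
  [set r | exists s t n, [/\ S s, S t, eorder (s * t) = Some n
     & r = flatten (nseq n [:: (s, true); (t, true)])]].

(* Coxeter systems in the sense of Bourbaki, for a subgroup [H] of an ambient
   group; a Coxeter group in its own right is the case [H = [set: W]]. *)
Definition coxeter_system (W : groupType) (H S : set W) : Prop :=
  (forall s, S s -> eorder s = Some 2) /\
  presented H S (coxeter_relators S).

Definition coxeter_matrix (W : groupType) (S : set W)
    (m : W -> W -> option nat) : Prop :=
  forall s t, S s -> S t -> eorder (s * t) = m s t.

(* The value 0 outside of the subgroup generated by [S] is junk (elements of
   [S] being involutions, words in [S] reach all of that subgroup). *)
Definition len (W : groupType) (S : set W) (w : W) : nat :=
  if pselect (exists n, `[< exists s : seq W,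
       [/\ forall x, x \in s -> S x, \prod_(x <- s) x = w & size s = n] >])
  is left h then ex_minn h else 0%N.

Definition reflections (W : groupType) (S : set W) : set W :=
  [set t | exists w s, S s /\ t = w * s * w^-1].

Definition Nset (W : groupType) (S : set W) (w : W) : set W :=
  [set t | reflections S t /\ (len S (w * t) < len S w)%N].

Definition chi (W : groupType) (S H : set W) : set W :=
  [set t | reflections S t /\ Nset S t `&` H = [set t]].

Definition perp (W : groupType) (S : set W) (s : W) : set W :=
  [set r | S r /\ r * s = s * r].

Definition dcoset (W : groupType) (B C : set W) (x : W) : set W :=
  [set z | exists b c, [/\ gen B b, gen C c & z = b * x * c]].

Definition min_reps (W : groupType) (S I B C : set W) : set W :=
  [set x | gen I x /\ forall z, dcoset B C x z -> (len S x <= len S z)%N].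

Definition Jtilde (W : groupType) (I J : set W) : set W :=
  [set t | exists w s, [/\ gen I w, J s & t = w * s * w^-1]].

(* [nu] and [frep] are definite descriptions: under the hypotheses of the
   theorem the set given to [xget] is a singleton (for tt, tu in Jtilde), and
   the default value 1 is not used. *)
Definition nu (W : groupType) (I J : set W) (tt : W) : W :=
  xget 1 [set t | J t /\ exists2 x, gen I x & tt = x * t * x^-1].

Definition frep (W : groupType) (S I J : set W) (ts tt : W) : W :=
  let s := nu I J ts in
  let t := nu I J tt in
  let B := I `&` perp S s in
  let C := I `&` perp S t in
  xget 1 [set d | min_reps S I B C d /\
    exists x y, [/\ gen I x, gen I y, ts = x * s * x^-1, tt = y * t * y^-1
      & dcoset B C d (x^-1 * y)]].

(* If [ts != tt] and [s = t], then [frep] is not 1 (else [ts = tt]), so it has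
   length at least 2 as soon as it is not in [I]. *)
Definition mtilde (W : groupType) (S I J : set W) (ts tt : W) : option nat :=
  let s := nu I J ts in
  let t := nu I J tt in
  let f := frep S I J ts tt in
  if ts == tt then Some 1%N
  else if s == t then
    if f \in I then omap half (eorder (s * f)) else None
  else if f == 1 then eorder (s * t) else None.

(* Main.v *)
Require Import Defs.
From mathcomp Require Import all_boot.
From mathcomp Require Import all_classical.

Set Implicit Arguments.
Unset Strict Implicit.
Unset Printing Implicit Defensive.

Local Open Scope classical_set_scope.
Local Open Scope group_scope.

Ltac gsimp :=
  rewrite ?(invgM, invgK, invg1, mulgA, mulgV, mulVg, mulgK, mulgVK, mul1g, mulg1).

(** The main tool is the inversion cocycle. The parity of the number of times that
    a reflection r occurs among the reflections of a word depends only on the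
    value g of the word, because every relator has parity zero. This parity
    [eta g r] satisfies
    eta (g h) r = eta g r + eta h (g^-1 r g), and eta g r holds exactly when
    r g is shorter than g. Exchange, deletion, minimal coset representatives and
    the behaviour of two simultaneous descents follow.

    Presentation. W is the semidirect product of the group generated by Jtilde
    and W_I, so Reidemeister-Schreier rewriting applies: read a word in S while
    following the image x in W_I of the prefix read so far, letters of J being
    sent to 1, and write down x s x^-1 for each letter s of J. A relator within I
    disappears and one within J is conjugated. For s in J and u in I the order of
    su is even, or s and u would be conjugate, and (su)^2k becomes the k-th power
    of a product of two conjugates of s which is conjugate to (su)^2. Hence an equality
    of words in Jtilde that holds in W follows from the relators of Jtilde
    ([Jtilde_coxeter]).

    Canonical generators. For x in W_I and s in J the inversions of x s x^-1 are
    x s x^-1 itself and some conjugates of elements of I. The latter are not in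
    the subgroup generated by Jtilde, on which the character of W that is -1 on I
    and 1 on J is trivial ([eta_Jtilde]). Conversely, write an element t of
    chi as a shortest product of elements of Jtilde: the first factor is an
    inversion of t, hence equal to t ([Jtilde_chi]).

    Coxeter matrix. The product of x s x^-1 and y t y^-1 is conjugate to
    s d t d^-1, where d is a shortest element of the double coset of x^-1 y
    modulo the parabolic subgroups generated by the elements of I that commute
    with s and with t ([frepP]). The finite entries are then read off, and it remains to see that s d t d^-1 has infinite order when d is
    not 1 and s differs from t, or when d has length at least 2 and s = t
    ([infinite_order]). No letter of J can cross a copy of d or d^-1 in the
    alternating product s d t d^-1 s d t d^-1 ..., so that its first letter stays
    a descent. The property [guarded] makes this an induction on the number of
    factors ([guarded_step]), the case of a letter of J and one of I that are
    both descents being governed by their dihedral subgroup. *)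

(** * Words, orders and presentations in a group *)

Section Groups.
Variable W : groupType.
Implicit Types (X Y : set W) (v w : seq W) (x y g r s t : W).

Definition word_on X v := forall x, x \in v -> X x.

Definition wprod v : W := \prod_(x <- v) x.

Lemma word_on_cons X x v : word_on X (x :: v) <-> X x /\ word_on X v.
Proof.
split=> [h | [hx hv] y]; first by split=> [|y yv]; apply: h; rewrite inE ?eqxx ?yv ?orbT.
by rewrite inE => /orP[/eqP-> //|/hv].
Qed.

Lemma word_on_cat X v w : word_on X (v ++ w) <-> word_on X v /\ word_on X w.
Proof.
split=> [h | [hv hw] y].
  by split=> y yv; apply: h; rewrite mem_cat yv ?orbT.
by rewrite mem_cat => /orP[/hv|/hw].
Qed.

Lemma word_on_rev X v : word_on X v -> word_on X (rev v).
Proof. by move=> h x; rewrite mem_rev => /h. Qed.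

Lemma sub_word_on X Y v : X `<=` Y -> word_on X v -> word_on Y v.
Proof. by move=> XY h x /h /XY. Qed.

Lemma wprod_nil : wprod [::] = 1.
Proof. exact: big_nil. Qed.

Lemma wprod_cons x v : wprod (x :: v) = x * wprod v.
Proof. exact: big_cons. Qed.

Lemma wprod_cat v w : wprod (v ++ w) = wprod v * wprod w.
Proof. exact: big_cat. Qed.

Lemma wprod_seq1 x : wprod [:: x] = x.
Proof. exact: big_seq1. Qed.

Lemma gen_min X (A : set W) : A 1 -> (forall x y, A x -> A y -> A (x / y)) ->
  X `<=` A -> gen X `<=` A.
Proof. by move=> A1 AM XA x; apply; split. Qed.

Lemma gen_sub X : X `<=` gen X.
Proof. by move=> x Xx A [_ XA]; apply: XA. Qed.

Lemma gen1 X : gen X 1.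
Proof. by move=> A [[]]. Qed.

Lemma genF X x y : gen X x -> gen X y -> gen X (x / y).
Proof.
by move=> hx hy A hA; case: (hA) => -[_ AM] _; apply: AM; [apply: hx | apply: hy].
Qed.

Lemma genV X x : gen X x -> gen X x^-1.
Proof. by move=> /(genF (@gen1 X)); rewrite mul1g. Qed.

Lemma genM X x y : gen X x -> gen X y -> gen X (x * y).
Proof. by move=> hx /genV /(genF hx); rewrite invgK. Qed.

Lemma genS X Y : X `<=` Y -> gen X `<=` gen Y.
Proof.
move=> XY; refine (gen_min (@gen1 Y) _ _) => [x y|x /XY].
  exact: genF.
exact: gen_sub.
Qed.

Lemma wprod_rev X v : (forall x, X x -> x * x = 1) -> word_on X v ->
  wprod (rev v) = (wprod v)^-1.
Proof.
move=> X2; elim: v => [|x v IH]; first by rewrite /rev /= wprod_nil invg1.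
move/word_on_cons=> [/X2 hx /IH hv].
by rewrite rev_cons -cats1 wprod_cat wprod_seq1 wprod_cons invgM hv (mulg1_eq hx).
Qed.

(** Inverses of words can be spelled without inverse letters, as the generators
    are involutions. *)
Lemma gen_word X g : (forall x, X x -> x * x = 1) -> gen X g ->
  exists2 v, word_on X v & wprod v = g.
Proof.
move=> X2; move: g; refine (gen_min _ _ _) => [|x y [v hv <-] [w hw <-]|x Xx].
- by exists [::] => //; rewrite wprod_nil.
- exists (v ++ rev w); first by apply/word_on_cat; split=> //; apply: word_on_rev.
  by rewrite wprod_cat (wprod_rev X2).
- by exists [:: x]; rewrite ?wprod_seq1 //; apply/word_on_cons.
Qed.

Lemma invol_conj x g : x * x = 1 -> (g * x * g^-1) * (g * x * g^-1) = 1.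
Proof. by move=> hx; gsimp; rewrite -(mulgA g) hx; gsimp. Qed.

Lemma expg_conj g x n : (g * x * g^-1) ^+ n = g * x ^+ n * g^-1.
Proof.
elim: n => [|n IH]; first by rewrite !expg0; gsimp.
by rewrite !expgS IH; gsimp.
Qed.

Variant eorder_spec x : option nat -> Prop :=
| EorderSome n of (0 < n)%N & x ^+ n = 1
    & (forall k, (0 < k)%N -> x ^+ k = 1 -> (n <= k)%N) : eorder_spec x (Some n)
| EorderNone of (forall k, (0 < k)%N -> x ^+ k <> 1) : eorder_spec x None.

Lemma eorderP x : eorder_spec x (eorder x).
Proof.
rewrite /eorder; case: pselect => [h|h].
  case: ex_minnP => n /andP[n0 /eqP xn] nmin; constructor=> // k k0 /eqP xk.
  by apply: nmin; rewrite k0.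
by constructor=> k k0 xk; apply: h; exists k; rewrite k0; apply/eqP.
Qed.

Lemma eorder_ext x y : (forall n, x ^+ n = 1 <-> y ^+ n = 1) -> eorder x = eorder y.
Proof.
move=> h; case: eorderP => [n n0 xn nmin|hx]; case: eorderP => [m m0 ym mmin|hy] //.
- by congr Some; apply/eqP; rewrite eqn_leq nmin ?mmin //; apply/h.
- by case: (hy _ n0); apply/h.
- by case: (hx _ m0); apply/h.
Qed.

Lemma eorder_conj g x : eorder (g * x * g^-1) = eorder x.
Proof.
apply: eorder_ext => n; rewrite expg_conj; split=> [h|->]; last by gsimp.
by apply: (mulgI g); rewrite (divg1_eq h) mulg1.
Qed.

Lemma eorder1 : eorder (1 : W) = Some 1%N.
Proof.
case: eorderP => [n n0 _ nmin|/(_ 1%N)]; last by case.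
by congr Some; apply/eqP; rewrite eqn_leq n0 nmin.
Qed.

Lemma eorder2 x : eorder x = Some 2 <-> x * x = 1 /\ x <> 1.
Proof.
split=> [|[xx x1]].
  case: eorderP => // n n0 xn nmin [n2]; rewrite {n}n2 in n0 xn nmin *.
  by split=> [|x1] //; have := nmin 1%N isT x1.
case: eorderP => [n n0 xn nmin|/(_ 2 isT)//].
have := nmin 2 isT xx; case: n n0 xn {nmin} => [|[|[|n]]] //.
Qed.

Lemma eorder_sq (p : W) : (forall n, p ^+ n = 1 -> ~~ odd n) ->
  eorder (p * p) = omap half (eorder p).
Proof.
move=> peven.
have pp n : (p * p) ^+ n = p ^+ n.*2 by rewrite -expg2 -expgnA mul2n.
case: (eorderP p) => [m m0 pm mmin|pinf] /=; case: eorderP => [n n0 ppn nmin|ppinf] //=.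
- have mE : m = m./2.*2 by rewrite even_halfK ?peven.
  congr Some; apply/eqP; rewrite eqn_leq; apply/andP; split.
    by apply: nmin; rewrite ?pp -?mE // -double_gt0 -mE.
  by rewrite -leq_double -mE; apply: mmin; rewrite ?double_gt0 -?pp.
- by case: (ppinf m) => //; rewrite pp -addnn expgnDr pm mul1g.
- by rewrite pp in ppn; case: (pinf n.*2); rewrite ?double_gt0.
Qed.

Lemma expg_mul_swap s t n : s * (t * s) ^+ n = (s * t) ^+ n * s.
Proof.
by elim: n => [|n IH]; rewrite ?expg0 ?mul1g ?mulg1 // expgSr mulgA IH expgSr !mulgA.
Qed.

Fixpoint alternating n s t := if n is k.+1 then s :: alternating k t s else [::].

Lemma size_alternating n s t : size (alternating n s t) = n.
Proof. by elim: n s t => //= n IH s t; rewrite IH. Qed.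

Lemma wprod_alternating n s t : wprod (alternating (n + n) s t) = (s * t) ^+ n.
Proof.
elim: n => [|n IH]; first exact: wprod_nil.
by rewrite addSn addnS /= !wprod_cons IH expgS mulgA.
Qed.

Lemma alternating_word_on s t n : word_on [set s; t] (alternating n s t).
Proof.
have h k : word_on [set s; t] (alternating k s t) /\ word_on [set s; t] (alternating k t s).
  elim: k => [|k [IH1 IH2]]; first by split.
  by split=> /=; apply/word_on_cons; split=> //; [left|right].
by have [] := h n.
Qed.

Definition positive v := [seq (x, true) | x <- v].

Lemma unzip1_positive v : unzip1 (positive v) = v.
Proof. by rewrite /unzip1 /positive -map_comp map_id. Qed.

Lemma unzip1_relator n s t :
  unzip1 (flatten (nseq n [:: (s, true); (t, true)])) = alternating (n + n) s t.
Proof. by elim: n => [//|n IH]; rewrite addSn addnS /= IH. Qed.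

Lemma word_eval_cat (v w : seq (W * bool)) : word_eval (v ++ w) = word_eval v * word_eval w.
Proof. exact: big_cat. Qed.

Lemma word_eval_cons (a : W * bool) (w : seq (W * bool)) :
  word_eval (a :: w) = letter a * word_eval w.
Proof. exact: big_cons. Qed.

Lemma word_eval_nil : word_eval [::] = 1 :> W.
Proof. exact: big_nil. Qed.

Lemma word_eval_positive v : word_eval (positive v) = wprod v.
Proof. by rewrite /word_eval /positive big_map; apply: eq_bigr. Qed.

Lemma word_eval_relator n s t :
  word_eval (flatten (nseq n [:: (s, true); (t, true)])) = (s * t) ^+ n.
Proof.
elim: n => [|n IH] /=; first by rewrite word_eval_nil.
by rewrite !word_eval_cons IH expgS mulgA.
Qed.

Lemma pres_word_eval (X : set W) (v w : seq (W * bool)) :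
  pres_eq X (coxeter_relators X) v w -> word_eval v = word_eval w.
Proof.
elim=> {v w} [//|v w _ -> //|u v w _ -> _ -> //|u v x b _|u v r].
  rewrite !word_eval_cat !word_eval_cons word_eval_nil mulg1.
  by case: b; rewrite /letter /= ?mulgV ?mulVg mul1g.
move=> [s [t [n [_ _]]]]; case: eorderP => // m _ st _ [mn] ->.
by rewrite -mn !word_eval_cat word_eval_relator st mul1g.
Qed.

Lemma pres_eq_cat (X : set W) (R : set (seq (W * bool))) (a b u v : seq (W * bool)) :
  pres_eq X R u v -> pres_eq X R (a ++ u ++ b) (a ++ v ++ b).
Proof.
elim=> {u v} [w|v w _|u v w _ h1 _ h2|u v x c Xx|u v r Rr].
- exact: pres_refl.
- exact: pres_sym.
- exact: pres_trans h1 h2.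
- by rewrite -!catA (catA a) (catA a u); apply: pres_cancel.
- by rewrite -!catA (catA a) (catA a u); apply: pres_relator.
Qed.

Lemma coxeter_relator_pres (X : set W) s t n : X s -> X t -> eorder (s * t) = Some n ->
  pres_eq X (coxeter_relators X) (flatten (nseq n [:: (s, true); (t, true)])) [::].
Proof.
move=> Xs Xt st; rewrite -[flatten _]cats0 -[flatten _]cat0s -catA.
by apply: pres_relator; exists s, t, n.
Qed.

(** The reflections of a word x1 ... xk are the k elements
    x1 ... x(i-1) xi x(i-1)^-1 ... x1^-1; [rpar v r] is the parity of the number
    of times that [r] occurs among those of [v]. *)
Fixpoint rpar v r : bool :=
  if v is x :: v' then (r == x) (+) rpar v' (x^-1 * r * x) else false.

Lemma rpar_cat v w r :
  rpar (v ++ w) r = rpar v r (+) rpar w ((wprod v)^-1 * r * wprod v).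
Proof.
elim: v r => [|x v IH] r /=; first by rewrite wprod_nil; gsimp.
by rewrite IH wprod_cons addbA; gsimp.
Qed.

Lemma rpar_split v r : rpar v r ->
  exists a x b, v = a ++ x :: b /\ r = wprod a * x * (wprod a)^-1.
Proof.
elim: v r => [//|x v IH] r /=; have [->|_] := eqVneq r x.
  by move=> _; exists [::], x, v; rewrite wprod_nil; split=> //; gsimp.
rewrite addFb => /IH[a [y [b [-> hr]]]]; exists (x :: a), y, b; split=> //.
have -> : r = x * (x^-1 * r * x) * x^-1 by gsimp.
by rewrite hr wprod_cons; gsimp.
Qed.

(** The exchange condition at the level of words: the reflection a x a^-1 of a
    word a x b, multiplied by its value, cancels the letter x. *)
Lemma rpar_delete v r : (forall x, x \in v -> x * x = 1) -> rpar v r ->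
  exists a x b, v = a ++ x :: b /\ r * wprod v = wprod (a ++ b).
Proof.
move=> v2 /rpar_split[a [x [b [vE ->]]]]; exists a, x, b; split=> //.
have x2 : x * x = 1 by apply: v2; rewrite vE mem_cat inE eqxx orbT.
by rewrite vE !wprod_cat wprod_cons; gsimp; rewrite -(mulgA (wprod a)) x2; gsimp.
Qed.

End Groups.

Arguments gen1 {W} X.

(** * Inversions and length in a Coxeter group *)

Section Coxeter.
Variables (W : groupType) (S : set W).
Hypothesis hS : coxeter_system [set: W] S.
Implicit Types (K : set W) (v w : seq W) (x y g r s t : W).

Lemma cox_sq s : S s -> s * s = 1.
Proof. by move=> /hS.1 /eorder2[]. Qed.

Lemma cox_neq1 s : S s -> s <> 1.
Proof. by move=> /hS.1 /eorder2[]. Qed.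

Lemma coxV s : S s -> s^-1 = s.
Proof. by move=> /cox_sq /mulg1_eq. Qed.

Lemma coxK s x : S s -> s * (s * x) = x.
Proof. by move=> /cox_sq ss; rewrite mulgA ss mul1g. Qed.

Lemma cox_word g : exists2 v, word_on S v & wprod v = g.
Proof. by apply: (gen_word cox_sq); rewrite -hS.2.1. Qed.

Lemma cox_pres v : word_on S v -> wprod v = 1 ->
  pres_eq S (coxeter_relators S) (positive v) [::].
Proof.
move=> hv v1; apply/(hS.2.2 _ _).1; last first.
  by rewrite /word_eval /positive big_map -[RHS]v1; apply: eq_bigr.
by move=> a /mapP[x /hv Sx ->].
Qed.

Lemma conj_alternating s t n : S s ->
  s * ((t * s) ^+ n * t) * s^-1 = (s * t) ^+ n.+1 * s.
Proof. by move=> /coxV->; rewrite mulgA expg_mul_swap expgSr !mulgA. Qed.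

(** The reflections of s t s t ... are s, sts, ststs, ..., that is the (st)^k s. *)
Lemma rpar_alternating n s t r : S s -> S t ->
  rpar (alternating n s t) r = \big[addb/false]_(k < n) (r == (s * t) ^+ k * s).
Proof.
move=> Ss St; elim: n s t Ss St r => [|n IH] s t Ss St r; first by rewrite big_ord0.
rewrite big_ord_recl /= expg0 mul1g IH //; congr (_ (+) _).
apply: eq_bigr => k _; rewrite /bump add1n -conj_alternating //.
by apply/eqP/eqP => [<-|->]; gsimp.
Qed.

(** The relators have the parity of the trivial word: as (st)^n = 1, the
    reflections number k and n + k of the word (st)^n are equal. *)
Lemma rpar_relator n s t r : S s -> S t -> (s * t) ^+ n = 1 ->
  rpar (alternating (n + n) s t) r = false.
Proof.
move=> Ss St st; rewrite rpar_alternating // big_split_ord /=.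
rewrite -[X in _ (+) X](_ : \big[addb/false]_(k < n) (r == (s * t) ^+ k * s) = _).
  exact: addbb.
by apply: eq_bigr => k _; rewrite expgnDr st mul1g.
Qed.

(** A letter read twice in a row contributes the same reflection twice. *)
Lemma rpar_pres (v w : seq (W * bool)) : pres_eq S (coxeter_relators S) v w ->
  wprod (unzip1 v) = wprod (unzip1 w) /\ rpar (unzip1 v) =1 rpar (unzip1 w).
Proof.
rewrite /unzip1; elim => {v w} [//|v w _ [-> h]|u v w _ [-> h] _ [-> h']|u v x b Sx|u v r0].
- by split=> // r; rewrite h.
- by split=> // r; rewrite h.
- rewrite !map_cat /= !wprod_cat !wprod_cons coxK //; split=> // r.
  rewrite !rpar_cat /=; move: (_ * r * _) => q.
  have -> : (x^-1 * q * x == x) = (q == x).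
    apply/eqP/eqP => [h|->]; last by gsimp.
    by apply: (mulgI x^-1); apply: (mulIg x); rewrite h; gsimp.
  have -> : x^-1 * (x^-1 * q * x) * x = q.
    by gsimp; rewrite (coxV Sx) (cox_sq Sx) mul1g -mulgA (cox_sq Sx) mulg1.
  by rewrite addKb.
move=> [s [t [n [Ss St]]]]; case: eorderP => // m m0 st _ [mn] ->.
rewrite -{}mn !map_cat -!/(unzip1 _) unzip1_relator.
rewrite !wprod_cat wprod_alternating st mul1g; split=> // r.
by rewrite !rpar_cat rpar_relator // wprod_alternating st; gsimp.
Qed.

(** For a reflection r, this tells whether r is a left inversion of g. The word
    chosen for g is irrelevant by [rpar_wprod]; keeping the definition by words
    makes the cocycle rule [etaM] hold for all r in W. *)
Definition eta g r : bool :=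
  rpar (xget [::] [set v | word_on S v /\ wprod v = g]) r.

(** Both words become trivial when followed by the reverse of w, so both have
    the parity that this reverse contributes. *)
Lemma rpar_wprod v w : word_on S v -> word_on S w -> wprod v = wprod w ->
  rpar v =1 rpar w.
Proof.
move=> hv hw vw r.
have h u : word_on S u -> wprod u = wprod w ->
    rpar u r = rpar (rev w) ((wprod w)^-1 * r * wprod w).
  move=> hu uw.
  have huw : word_on S (u ++ rev w).
    by apply/word_on_cat; split=> //; apply: word_on_rev.
  have uw1 : wprod (u ++ rev w) = 1.
    by rewrite wprod_cat uw (wprod_rev cox_sq) // mulgV.
  have [_ /(_ r)] := rpar_pres (cox_pres huw uw1).
  rewrite !unzip1_positive rpar_cat uw /=.
  by case: (rpar u r); case: (rpar (rev w) _).
by rewrite (h _ hv vw) (h _ hw).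
Qed.

Lemma etaE v r : word_on S v -> eta (wprod v) r = rpar v r.
Proof.
move=> hv; rewrite /eta; set A := [set _ | _].
have [] : A (xget [::] A) by apply: xgetPex; exists v.
by move=> hx xv; apply: rpar_wprod.
Qed.

Lemma eta1 r : eta 1 r = false.
Proof. by rewrite -wprod_nil etaE. Qed.

Lemma etaM g h r : eta (g * h) r = eta g r (+) eta h (g^-1 * r * g).
Proof.
have [v hv <-] := cox_word g; have [w hw <-] := cox_word h.
rewrite -wprod_cat !etaE ?rpar_cat //.
by apply/word_on_cat.
Qed.

Lemma eta_gen s r : S s -> eta s r = (r == s).
Proof.
move=> Ss; have hs : word_on S [:: s] by apply/word_on_cons.
by have := etaE r hs; rewrite wprod_seq1 /= addbF.
Qed.

Lemma reflection_gen s : S s -> reflections S s.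
Proof. by move=> Ss; exists 1, s; split=> //; gsimp. Qed.

Lemma reflection_conj g r : reflections S r -> reflections S (g * r * g^-1).
Proof. by move=> [x [s [Ss ->]]]; exists (g * x), s; split=> //; gsimp. Qed.

Lemma reflection_conjV g r : reflections S r -> reflections S (g^-1 * r * g).
Proof. by move=> /(reflection_conj g^-1); rewrite invgK. Qed.

Lemma reflection_sq r : reflections S r -> r * r = 1.
Proof. by move=> [x [s [/cox_sq Ss ->]]]; apply: invol_conj. Qed.

Lemma reflection_neq1 r : reflections S r -> r <> 1.
Proof.
move=> [x [s [/cox_neq1 Ss ->]]] h; apply: Ss; apply: (mulgI x).
by rewrite (divg1_eq h) mulg1.
Qed.

(** In r = x s x^-1 the contributions of x and x^-1 cancel by the cocycle rule,
    and the middle letter contributes r once. *)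
Lemma eta_refl r : reflections S r -> eta r r.
Proof.
move=> [x [s [Ss rE]]].
have xrx : x^-1 * r * x = s by rewrite rE; gsimp.
have sxrxs : (x * s)^-1 * r * (x * s) = s by rewrite rE; gsimp.
have := eta1 r; rewrite -(mulgV x) etaM xrx.
have -> : eta r r = eta (x * s * x^-1) r by rewrite -rE.
by rewrite !etaM xrx sxrxs (eta_gen _ Ss) eqxx; case: (eta x r); case: (eta x^-1 s).
Qed.

Lemma len_word g : exists v, [/\ word_on S v, wprod v = g & size v = len S g].
Proof.
rewrite /len; case: pselect => [h|[]].
  by case: ex_minnP => n /asboolP[v [hv vg <-]] _; exists v.
by have [v hv vg] := cox_word g; exists (size v); apply/asboolP; exists v.
Qed.

Lemma len_le v : word_on S v -> (len S (wprod v) <= size v)%N.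
Proof.
move=> hv; rewrite /len; case: pselect => // h.
by case: ex_minnP => n _; apply; apply/asboolP; exists v.
Qed.

Lemma len1 : len S 1 = 0%N.
Proof. by apply/eqP; rewrite -leqn0 -wprod_nil; apply: len_le. Qed.

Lemma len_eq0 g : len S g = 0%N -> g = 1.
Proof. by have [v [_ <- <-]] := len_word g => /size0nil ->; rewrite wprod_nil. Qed.

Lemma len_gen_le s : S s -> (len S s <= 1)%N.
Proof.
by move=> Ss; rewrite -[s]wprod_seq1; apply: len_le; apply/word_on_cons.
Qed.

Lemma lenV_le g : (len S g^-1 <= len S g)%N.
Proof.
have [v [hv <- <-]] := len_word g.
rewrite -(wprod_rev cox_sq hv) -(size_rev v); apply: len_le.
exact: word_on_rev.
Qed.

Lemma lenV g : len S g^-1 = len S g.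
Proof.
by apply/eqP; rewrite eqn_leq lenV_le -{1}(invgK g) lenV_le.
Qed.

Lemma eta_len_lt g r : eta g r -> (len S (r * g) < len S g)%N.
Proof.
have [v [hv <- <-]] := len_word g; rewrite etaE // => /(rpar_delete (fun x xv => cox_sq (hv x xv))).
move=> [a [x [b [vE ->]]]]; move: hv; rewrite vE.
move=> /word_on_cat[ha /word_on_cons[_ hb]].
apply: (@leq_ltn_trans (size (a ++ b))); last by rewrite !size_cat /= addnS.
by apply: len_le; apply/word_on_cat.
Qed.

(** The cocycle rule and [eta_refl] make r an inversion of exactly one of g and
    r g, and the exchange condition makes that one the longer. *)
Lemma etaN g r : reflections S r -> eta (r * g) r = ~~ eta g r.
Proof.
by move=> hr; rewrite etaM eta_refl // mulVg mul1g.
Qed.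

Lemma eta_len g r : reflections S r -> eta g r = (len S (r * g) < len S g)%N.
Proof.
move=> hr; apply/idP/idP => [/eta_len_lt //|]; apply: contraTT => /negP/negP.
rewrite -etaN // => /eta_len_lt; rewrite mulgA reflection_sq // mul1g.
by rewrite -leqNgt => /ltnW.
Qed.

Lemma len_mul_gen s g : S s -> (len S (s * g) <= (len S g).+1)%N.
Proof.
move=> Ss; have [v [hv <- <-]] := len_word g.
rewrite -wprod_cons -[(size v).+1]/(size (s :: v)); apply: len_le.
exact/word_on_cons.
Qed.

Lemma len_mul_genN s g : S s -> ~~ eta g s -> len S (s * g) = (len S g).+1.
Proof.
move=> Ss hs; apply/eqP; rewrite eqn_leq len_mul_gen //=.
have := eta_len (s * g) (reflection_gen Ss).
by rewrite etaN ?hs ?coxK //; apply: reflection_gen.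
Qed.

(** The deletion condition: letters are prepended one at a time, and one that does
    not increase the length is exchanged for the removal of a later letter, so
    that the alphabet does not grow. *)
Lemma gen_len_word K g : K `<=` S -> gen K g ->
  exists v, [/\ word_on K v, wprod v = g & size v = len S g].
Proof.
move=> KS /(gen_word (fun x Kx => cox_sq (KS x Kx))) [v + <-].
elim: v => [|x v IH]; first by exists [::]; rewrite wprod_nil len1.
move=> /word_on_cons[Kx /IH[w [hw wv ws]]]; rewrite wprod_cons -wv.
have [xw|xw] := boolP (eta (wprod w) x); last first.
  exists (x :: w); split; first exact/word_on_cons.
    by rewrite wprod_cons.
  by rewrite len_mul_genN //= ?ws ?wv //; apply: KS.
move: (xw); rewrite etaE; last exact: sub_word_on KS hw.
move=> /(rpar_delete (fun y yw => cox_sq (KS y (hw y yw))))[a [y [b [wE xwE]]]].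
move: (hw); rewrite {1}wE => /word_on_cat[ha /word_on_cons[_ hb]].
have hab : word_on K (a ++ b) by apply/word_on_cat.
exists (a ++ b); rewrite xwE; split=> //; apply/eqP; rewrite eqn_leq len_le ?andbT; last first.
  exact: sub_word_on KS hab.
have := len_mul_gen (x * wprod w) (KS _ Kx); rewrite coxK ?xwE; last exact: KS.
by rewrite wv -ws wE !size_cat /= addnS ltnS.
Qed.

(** W_K meets S in K only, since a reduced word for s on K has one letter. *)
Lemma gen_gen K s : K `<=` S -> S s -> gen K s -> K s.
Proof.
move=> KS Ss /(gen_len_word KS)[v [hv vs]].
have := len_gen_le Ss; move=> + sz; rewrite -sz; case: v hv vs {sz} => [|x [|//]].
  by rewrite wprod_nil => _ s1; case: (cox_neq1 Ss).
by rewrite wprod_seq1 => /word_on_cons[hx _] <-.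
Qed.

(** The first letter of a reduced word on K is a descent. *)
Lemma gen_descent K g : K `<=` S -> gen K g -> g <> 1 -> exists2 u, K u & eta g u.
Proof.
move=> KS /(gen_len_word KS)[[|u v] [hv <- vs]]; first by rewrite wprod_nil.
move=> _; move/word_on_cons: (hv) => [Ku hv']; exists u => //.
rewrite eta_len; last exact/reflection_gen/KS.
rewrite -vs wprod_cons coxK; last exact: KS.
by rewrite ltnS; apply: len_le; apply: sub_word_on KS hv'.
Qed.

Lemma ex_len_min (P : W -> Prop) : (exists g, P g) ->
  exists2 g, P g & forall h, P h -> (len S g <= len S h)%N.
Proof.
move=> [g Pg].
have : exists n, `[< exists2 g, P g & len S g = n >].
  by exists (len S g); apply/asboolP; exists g.
move=> /ex_minnP[n /asboolP[h Ph <-] nmin]; exists h => // x Px.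
by apply: nmin; apply/asboolP; exists x.
Qed.

(** * Cosets of parabolic subgroups *)

Definition coset_min K g := forall x, gen K x -> (len S g <= len S (x * g))%N.

Lemma coset_min_ex K g : exists2 a, gen K a & coset_min K (a * g).
Proof.
have [|_ [a Ka ->] amin] := @ex_len_min (fun h => exists2 a, gen K a & h = a * g).
  by exists g, 1; rewrite ?mul1g //; apply: gen1.
exists a => // x Kx; apply: amin; exists (x * a); last by rewrite mulgA.
exact: genM.
Qed.

Lemma eta_coset_min K g r : coset_min K g -> reflections S r -> gen K r -> ~~ eta g r.
Proof. by move=> gmin hr Kr; rewrite eta_len // -leqNgt; apply: gmin. Qed.

(** As no reflection of W_K is an inversion of g, the cocycle rule leaves only the
    part of x g in W_K. *)
Lemma eta_mul_coset_min K x g r : coset_min K g -> reflections S r -> gen K r ->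
  gen K x -> eta (x * g) r = eta x r.
Proof.
move=> gmin hr Kr Kx; rewrite etaM (negbTE (eta_coset_min gmin _ _)) ?addbF //.
  exact: reflection_conjV.
by apply: genM => //; apply: genM => //; apply: genV.
Qed.

(** Otherwise g = a^-1 b with b shortest in its coset and a^-1 nontrivial, and a
    descent of a^-1 in K would be one of g. *)
Lemma coset_minP K g : K `<=` S -> (forall u, K u -> ~~ eta g u) -> coset_min K g.
Proof.
move=> KS gu; have [a Ka agmin] := coset_min_ex K g.
have [a1|a1] := pselect (a = 1); first by move: agmin; rewrite a1 mul1g.
have [||u Ku au] := @gen_descent K a^-1 KS.
- exact: genV.
- by move=> h; apply: a1; rewrite -[a]invgK h invg1.
have := gu _ Ku; rewrite -[g](mulKg a) (eta_mul_coset_min agmin) ?au //.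
- exact/reflection_gen/KS.
- exact: gen_sub.
- exact: genV.
Qed.

(** * Dihedral parabolic subgroups *)

Lemma alternating_split s t n i : S s -> S t -> (i < n)%N ->
  exists a x b, alternating n s t = a ++ x :: b /\
    wprod a * x * (wprod a)^-1 = (s * t) ^+ i * s.
Proof.
elim: i n s t => [|i IH] [//|n] s t Ss St.
  by move=> _; exists [::], s, (alternating n t s); rewrite wprod_nil; split=> //; gsimp.
rewrite ltnS => /(IH _ _ _ St Ss)[a [x [b [hab hx]]]].
exists (s :: a), x, b; rewrite /= hab; split=> //.
by rewrite -conj_alternating // -hx wprod_cons; gsimp.
Qed.

(** Two equal consecutive letters would cancel. *)
Lemma reduced_alternating s t v : S s -> S t -> word_on [set s; t] v ->
    size v = len S (wprod v) ->
  v = alternating (size v) s t \/ v = alternating (size v) t s.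
Proof.
move=> Ss St; elim: v => [|x v IH]; first by left.
move=> /word_on_cons[hx hv] /= sz.
have stS : [set s; t] `<=` S by move=> _ [] ->.
have vS : word_on S v by apply: sub_word_on stS hv.
have szv : size v = len S (wprod v).
  apply/eqP; rewrite eqn_leq len_le // andbT -ltnS sz wprod_cons.
  by apply: len_mul_gen; apply: stS.
have [vE|vE] := IH hv szv; case: hx => xE; rewrite {x}xE in sz *.
- case: v sz {IH hv szv} vE vS => [|y v] sz; first by left.
  move=> /= [ys _]; rewrite {y}ys in sz * => /word_on_cons[_ vS].
  move: sz; rewrite !wprod_cons coxK // => sz.
  by have := len_le vS; rewrite -sz /= ltnNge leqnSn.
- by right; rewrite {1}vE.
- by left; rewrite {1}vE.
- case: v sz {IH hv szv} vE vS => [|y v] sz; first by right.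
  move=> /= [ys _]; rewrite {y}ys in sz * => /word_on_cons[_ vS].
  move: sz; rewrite !wprod_cons coxK // => sz.
  by have := len_le vS; rewrite -sz /= ltnNge leqnSn.
Qed.

(** If a reduced word s t s ... with n letters has the inversion t, then t is some
    (st)^i s with i < n. Hence (st)^(i+1) = 1 with i + 1 at most n, and the word
    has all (st)^j s among its reflections. *)
Lemma eta_alternating s t n : S s -> S t -> let c := wprod (alternating n s t) in
  len S c = n -> eta c t ->
  exists2 m, (0 < m)%N /\ (s * t) ^+ m = 1 & forall i, eta c ((s * t) ^+ i * s).
Proof.
move=> Ss St c cn; have stS : [set s; t] `<=` S by move=> _ [] ->.
have cS : word_on S (alternating n s t).
  exact: sub_word_on stS (@alternating_word_on _ s t n).
have small i : (i < n)%N -> eta c ((s * t) ^+ i * s).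
  move=> /(alternating_split Ss St)[a [x [b [hab <-]]]].
  move: (cS); rewrite hab => /word_on_cat[aS /word_on_cons[xS bS]].
  rewrite eta_len; last exact/reflection_conj/reflection_gen.
  rewrite -[X in (_ < X)%N]/(len S c) cn /c hab wprod_cat wprod_cons; gsimp.
  rewrite -(mulgA (wprod a)) (cox_sq xS) mulg1 -wprod_cat.
  apply: (@leq_ltn_trans (size (a ++ b))).
    by apply: len_le; apply/word_on_cat.
  by rewrite -(size_alternating n s t) hab !size_cat /= addnS.
rewrite etaE // rpar_alternating // => ct.
have /existsP[i /eqP tE] : [exists i : 'I_n, t == (s * t) ^+ i * s].
  apply: contraTT ct => /existsPn tN; rewrite big1 // => i _.
  exact/negbTE/tN.
have st1 : (s * t) ^+ i.+1 = 1 by rewrite expgSr mulgA -tE cox_sq.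
exists i.+1 => // j; rewrite (divn_eq j i.+1) expgnDr mulnC expgnA st1 expg1n mul1g.
by apply: small; apply: leq_trans (ltn_ord i); apply: ltn_pmod.
Qed.

(** If both generators of a dihedral parabolic subgroup are descents of h, then
    all its reflections are inversions of h: the part of h in that subgroup is
    its longest element. *)
Lemma dihedral_inversions s t h i : S s -> S t -> eta h s -> eta h t ->
  eta h ((s * t) ^+ i * s).
Proof.
move=> Ss St hs ht; set K := [set s; t].
have KS : K `<=` S by move=> _ [] ->.
have Ks : gen K s by apply: gen_sub; left.
have Kt : gen K t by apply: gen_sub; right.
have [a Ka amin] := coset_min_ex K h.
have etaC r : reflections S r -> gen K r -> eta h r = eta a^-1 r.
  move=> hr Kr; rewrite -[h in LHS](mulKg a) (eta_mul_coset_min amin) //.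
  exact: genV.
have Kp k : gen K ((s * t) ^+ k).
  by elim: k => [|k IH]; [apply: gen1|rewrite expgSr; do !apply: genM].
have refl k : reflections S ((s * t) ^+ k * s).
  elim: k (s) (t) {hs ht K KS Ks Kt amin Ka etaC Kp} Ss St => [|k IH] x y Sx Sy.
    by rewrite mul1g; apply: reflection_gen.
  by rewrite -conj_alternating //; apply/reflection_conj/IH.
move: hs ht; rewrite !etaC //; try exact: reflection_gen; last exact: genM.
have [v [vK <- vs]] := gen_len_word KS (genV Ka).
have := reduced_alternating Ss St vK; rewrite vs => /(_ erefl)[] vE.
  move=> _ ct; rewrite vE in ct *.
  by have [//|_ _] := eta_alternating Ss St _ ct; rewrite -?vE.
move=> cs _; rewrite vE in cs *.
have [|m [m0 tsm]] := eta_alternating St Ss _ cs; first by rewrite -vE.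
(* As ts is the inverse of st, the two enumerations of the reflections of the
   finite dihedral group run in opposite directions. *)
move=> /(_ (m * i.+1 - i.+1)%N).
have tsE : t * s = (s * t)^-1 by rewrite invgM !coxV.
have -> // : (t * s) ^+ (m * i.+1 - i.+1) * t = (s * t) ^+ i * s.
rewrite expgnFr; last by rewrite leq_pmull.
by rewrite expgnA tsm expg1n mul1g tsE expVgn invgK expgSr mulgA -[LHS]mulgA cox_sq ?mulg1.
Qed.

(** By the cocycle rule, t is an inversion of s h as soon as sts is one of h, and
    likewise one and two letters further on. The conditions on st exclude that
    the inverted letter is already an inversion of the prefix ts or sts. *)
Section TwoDescents.
Variables (s t h : W).
Hypotheses (Ss : S s) (St : S t) (hs : eta h s) (ht : eta h t) (st : s <> t).

Lemma eta_descent2 : eta (s * h) t.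
Proof.
rewrite etaM eta_gen // (_ : t == s = false) ?addFb; last by apply/eqP => /esym.
by rewrite (coxV Ss) -[s * t]expg1; apply: dihedral_inversions.
Qed.

Lemma eta_descent3 : s * t <> t * s -> eta (t * s * h) s.
Proof.
move=> nst; rewrite etaM invgM !coxV // [eta _ (_ * _)](_ : _ = true); last first.
  by rewrite -(dihedral_inversions 2 Ss St hs ht) expg2 !mulgA.
rewrite etaM !eta_gen // (coxV St) (_ : s == t = false) ?addFb; last exact/eqP.
rewrite (_ : _ == s = false) //; apply/eqP => h1; apply: nst.
by apply: (mulgI t); rewrite mulgA h1 coxK.
Qed.

Lemma eta_descent4 : s * t <> t * s -> (s * t) ^+ 3 <> 1 -> eta (s * t * s * h) t.
Proof.
move=> nst nst3; rewrite etaM !invgM !coxV // [eta h _](_ : _ = true); last first.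
  by rewrite -(dihedral_inversions 3 Ss St hs ht) !expgS expg0 !mulgA mulg1.
rewrite !etaM !eta_gen // invgM !coxV // (_ : t == s = false) ?addFb; last by apply/eqP => /esym.
rewrite (_ : s * t * s == t = false) ?addFb; last first.
  by apply/eqP => h1; apply: nst; apply: (mulIg s); rewrite h1 -mulgA cox_sq // mulg1.
rewrite (_ : _ == s = false) //; apply/eqP => h1; apply: nst3.
by rewrite !expgS expg0 mulg1; apply: (mulgI s); rewrite mulg1 -[RHS]h1 -!mulgA coxK.
Qed.

End TwoDescents.

(** * Alternating products over a partition of the generators *)

Section Partition.
Variables I J : set W.
Hypotheses (hIJ : S = I `|` J) (hdisj : I `&` J = set0).
Hypothesis hconj : forall s t w : W, I s -> J t -> w * s * w^-1 <> t.
Implicit Types (d e i j u z : W).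

Lemma I_sub : I `<=` S. Proof. by rewrite hIJ => x; left. Qed.
Lemma J_sub : J `<=` S. Proof. by rewrite hIJ => x; right. Qed.

Lemma notIJ x : I x -> J x -> False.
Proof. by move=> Ix Jx; have : set0 x by rewrite -hdisj; split. Qed.

(** If (su)^(2k+1) = 1, then (su)^(k+1) conjugates u into s. *)
Lemma mixed_even s u n : J s -> I u -> (s * u) ^+ n = 1 -> ~~ odd n.
Proof.
move=> Js Iu; have [Ss Su] := (J_sub Js, I_sub Iu).
rewrite -[X in _ ^+ X](odd_double_half n); case: odd => // p1.
set k := n./2 in p1; case: (@hconj u s ((s * u) ^+ k.+1) Iu Js).
have pk : (s * u) ^+ k.+1 = (u * s) ^+ k.
  have -> : u * s = (s * u)^-1 by rewrite invgM !coxV.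
  rewrite expVgn; apply: divg1_eq; rewrite invgK -expgnDr.
  by rewrite -p1 -[k.*2]addnn addSn.
rewrite {1}pk -expg_mul_swap (_ : u * _ = s * (s * u) ^+ k.+1) ?mulgK //.
by rewrite expgS -!mulgA coxK.
Qed.

Lemma mixed_not3 s u : J s -> I u -> (s * u) ^+ 3 <> 1.
Proof. by move=> Js Iu /(mixed_even Js Iu). Qed.

Notation comm j := (I `&` perp S j).

Lemma comm_sub j : comm j `<=` I. Proof. by move=> x []. Qed.

Lemma commE j u : J j -> I u -> j * u = u * j -> comm j u.
Proof. by move=> Jj Iu ju; split=> //; split=> //; apply: I_sub. Qed.

Lemma gen_comm_commute j x : gen (comm j) x -> x * j = j * x.
Proof.
move: x; refine (gen_min _ _ _) => [|x y hx hy|x [_ []] //]; first by rewrite mul1g mulg1.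
rewrite -mulgA (_ : y^-1 * j = j * y^-1) ?mulgA ?hx //.
by apply: (mulgI y); rewrite mulVKg mulgA hy mulgK.
Qed.

Lemma eta_gen_I x r : gen I x -> eta x r -> exists g i, I i /\ r = g * i * g^-1.
Proof.
move=> Ix; have [v vI <-] := gen_word (fun x Ix => cox_sq (I_sub Ix)) Ix.
rewrite etaE; last exact: sub_word_on I_sub vI.
move=> /rpar_split[a [i [b [vE rE]]]]; exists (wprod a), i; split=> //.
by apply: vI; rewrite vE mem_cat inE eqxx orbT.
Qed.

(** The invariant which shows that an alternating product g of elements of J and
    of W_I, with first factor h in J, never collapses: h is the only letter of J
    that can become a descent of some d g with d in W_I, and it does so only
    across elements d that are products of letters commuting with h. *)
Definition guarded g h :=
  (forall u, I u -> ~~ eta g u) /\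
  forall d j, gen I d -> J j -> eta (d * g) j -> j = h /\ gen (comm j) d.

(** The inversions of an element of W_I are conjugate to elements of I, so that no
    letter of J is among them; h is therefore arbitrary. *)
Lemma guarded1 h : guarded 1 h.
Proof.
split=> [u _|d j Id Jj]; first by rewrite eta1.
rewrite mulg1 => /(eta_gen_I Id)[x [i [Ii jE]]].
by case: (@hconj i j x).
Qed.

Section Step.
Variables j e h g : W.
Hypotheses (Jj : J j) (he : min_reps S I (comm j) (comm h) e).
Hypotheses (e_neq : j <> h -> e <> 1) (e_eq : j = h -> (1 < len S e)%N).
Hypothesis hg : guarded g h.

Let Ie : gen I e := he.1.

Let coset_g : coset_min I g := coset_minP I_sub hg.1.

Lemma min_reps_left x y : gen (comm j) x -> gen (comm h) y -> (len S e <= len S (x * e * y))%N.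
Proof. by move=> hx hy; apply: he.2; exists x, y. Qed.

Lemma min_reps_comm_left : gen (comm j) e -> e = 1.
Proof.
move=> /genV ej; apply: len_eq0; apply/eqP; rewrite -leqn0.
by have := min_reps_left ej (gen1 (comm h)); rewrite mulVg mul1g len1.
Qed.

Lemma min_reps_comm_right : gen (comm h) e -> e = 1.
Proof.
move=> /genV eh; apply: len_eq0; apply/eqP; rewrite -leqn0.
by have := min_reps_left (gen1 (comm j)) eh; rewrite mul1g mulgV len1.
Qed.

(** For j = h, a factorisation of e through a single letter of I would bring the
    minimal length in its double coset down to 1. *)
Lemma double_coset_not_gen x y u : j = h -> I u -> gen (comm j) x -> gen (comm j) y ->
  e = x * u * y -> False.
Proof.
move=> jh Iu hx hy eE; have := e_eq jh; rewrite ltnNge => /negP; apply.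
apply: (leq_trans _ (len_gen_le (I_sub Iu))).
have -> : u = x^-1 * e * y^-1 by rewrite eE; gsimp.
by apply: min_reps_left; [|rewrite -jh]; apply: genV.
Qed.

(** Crossing e would require j = h and e commuting with j, but then e has length 0
    by minimality. *)
Lemma step_not_descent : ~~ eta (e * g) j.
Proof.
apply/negP => /(hg.2 _ _ Ie Jj)[jh /min_reps_comm_left e1].
by have := e_eq jh; rewrite e1 len1.
Qed.

Lemma step_descent : eta (j * e * g) j.
Proof.
by rewrite -mulgA etaN ?step_not_descent //; apply: reflection_gen; apply: J_sub.
Qed.

(** If u were a descent next to j, it would be a descent of e g, hence of e. This
    contradicts the minimality of e when u commutes with j; otherwise j is a
    descent of u e g, which forces e to be u times an element commuting with j. *)
Lemma step_no_I_descent u : I u -> ~~ eta (j * e * g) u.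
Proof.
move=> Iu; apply/negP => gu.
have [Sj Su] := (J_sub Jj, I_sub Iu).
have ju : j <> u by move=> ju; apply: (notIJ Iu); rewrite -ju.
have := eta_descent2 Sj Su step_descent gu ju; rewrite -mulgA coxK //.
have [com|ncom] := pselect (j * u = u * j).
  rewrite (eta_mul_coset_min coset_g) //; first last.
  - exact: gen_sub.
  - exact: reflection_gen.
  rewrite eta_len; last exact: reflection_gen.
  rewrite ltnNge => /negP; apply; rewrite -[u * e]mulg1.
  exact: (min_reps_left (gen_sub (commE Jj Iu com)) (gen1 (comm h))).
move=> _; have := eta_descent3 Sj Su step_descent gu ju ncom.
rewrite -!mulgA coxK // mulgA => /(hg.2 _ _ (genM (gen_sub Iu) Ie) Jj)[jh ue].
apply: (double_coset_not_gen jh Iu (gen1 (comm j)) ue).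
by rewrite mul1g coxK.
Qed.

(** Induction on the length of d. For d = 1, a second descent k would have to
    cross e, so e would commute with k = h and be 1. For d = u d', with u a descent
    in I, the induction hypothesis gives k = j and d' commuting with j. If u does
    not commute with j, then the dihedral subgroup of u and j has order at least
    8, so that j is still a descent after u j u has been stripped off. What remains
    is d e g, as d' commutes with j; hence d e commutes with j and e is the product
    of d'^-1, u and d e, which is excluded. *)
Lemma step_guard d k : gen I d -> J k -> eta (d * (j * e * g)) k ->
  k = j /\ gen (comm k) d.
Proof.
have [n] := ubnP (len S d); elim: n d => // n IH d dn Id Jk dk.
have [Sj Sk] := (J_sub Jj, J_sub Jk).
have [d1|d1] := pselect (d = 1).
  move: dk; rewrite d1 mul1g => gk; split; last exact: gen1.
  apply: contrapT => kj.
  have := eta_descent2 Sj Sk step_descent gk (fun h => kj (esym h)).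
  rewrite -mulgA coxK // => /(hg.2 _ _ Ie Jk)[kh ek].
  rewrite kh in kj ek; apply: (e_neq (fun h => kj (esym h))).
  exact: min_reps_comm_right.
have [u Iu du] := gen_descent I_sub Id d1.
have Su := I_sub Iu.
have dgu : eta (d * (j * e * g)) u.
  rewrite (eta_mul_coset_min (coset_minP I_sub step_no_I_descent)) //.
    exact: reflection_gen.
  exact: gen_sub.
have uk : u <> k by move=> uk; apply: (notIJ Iu); rewrite uk.
have Iud : gen I (u * d) by apply: genM => //; apply: gen_sub.
have udn : (len S (u * d) < n)%N.
  move: dn; rewrite ltnS; apply: leq_trans.
  by rewrite -eta_len //; apply: reflection_gen.
have := eta_descent2 Su Sk dgu dk uk.
rewrite mulgA => /(IH _ udn Iud Jk)[kj kud].
have [com|ncom] := pselect (u * k = k * u).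
  split=> //; rewrite -(coxK d Su); apply: genM => //.
  exact: gen_sub (commE Jk Iu (esym com)).
have nuk3 : (u * k) ^+ 3 <> 1.
  move=> uk3; apply: (mixed_not3 Jk Iu).
  by rewrite (_ : k * u = (u * k)^-1) ?expVgn ?uk3 ?invg1 // invgM !coxV.
have := eta_descent4 Su Sk dgu dk uk ncom nuk3.
have -> : u * k * u * (d * (j * e * g)) = d * e * g.
  rewrite -kj.
  have -> : u * k * u * (d * (k * e * g)) = u * (k * (u * d)) * k * (e * g) by gsimp.
  by rewrite -(gen_comm_commute kud) -!mulgA coxK // coxK.
move=> /(hg.2 _ _ (genM Id Ie) Jk)[kh kde]; exfalso.
have jh : j = h by rewrite -kj.
apply: (@double_coset_not_gen (u * d)^-1 (d * e) u jh Iu); rewrite -?kj //.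
  exact: genV.
by rewrite invgM (coxV Su) -!mulgA coxK // mulKg.
Qed.

Lemma guarded_step : guarded (j * e * g) j.
Proof. by split; [apply: step_no_I_descent|apply: step_guard]. Qed.

End Step.

Lemma min_repsV B C d : min_reps S I B C d -> min_reps S I C B d^-1.
Proof.
move=> [Id dmin]; split=> [|_ [b [c [hb hc ->]]]]; first exact: genV.
rewrite lenV -[b * _ * c]invgK lenV; apply: dmin.
by exists c^-1, b^-1; split; [exact: genV|exact: genV|gsimp].
Qed.

(** Multiplying by t d^-1 and then by s d preserves guardedness and makes s a
    descent, so no positive power is 1. *)
Lemma infinite_order s t d n : J s -> J t -> min_reps S I (comm s) (comm t) d ->
  (s <> t -> d <> 1) -> (s = t -> (1 < len S d)%N) ->
  (0 < n)%N -> (s * (d * t * d^-1)) ^+ n <> 1.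
Proof.
move=> Js Jt hd d_neq d_eq; set p := s * _; case: n => // n _.
have step_t g : guarded g s -> guarded (t * d^-1 * g) t.
  move=> hg; apply: (guarded_step Jt (min_repsV hd) _ _ hg) => [ts d1|ts].
    by apply: d_neq; [move=> st; apply: ts|rewrite -[d]invgK d1 invg1].
  by rewrite lenV; apply: d_eq.
have pg g : p * g = s * d * (t * d^-1 * g) by rewrite /p; gsimp.
have hp k : guarded (p ^+ k) s.
  elim: k => [|k IH]; first exact: guarded1.
  by rewrite expgS pg; apply: (guarded_step Js hd d_neq d_eq (step_t _ IH)).
have := step_descent Js hd d_eq (step_t _ (hp n)).
by rewrite -pg -expgS => ps p1; rewrite p1 eta1 in ps.
Qed.

(** t lies in the parabolic subgroup generated by I and s, whose elements in S are
    those of I and s. *)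
Lemma J_conj_inj s t x : J s -> J t -> gen I x -> t = x * s * x^-1 -> s = t.
Proof.
move=> Js Jt Ix tE; pose K := I `|` [set s].
have KS : K `<=` S by move=> y [/I_sub//|->]; apply: J_sub.
have IK y : gen I y -> gen K y by apply: genS => z; left.
have [|It|-> //] := gen_gen KS (J_sub Jt).
  rewrite tE; apply: genF; last exact: IK.
  by apply: genM; [exact: IK|apply: gen_sub; right].
by case: (notIJ It Jt).
Qed.

Lemma nuE x t : gen I x -> J t -> nu I J (x * t * x^-1) = t.
Proof.
move=> Ix Jt; rewrite /nu; set A := [set _ | _].
have [] : A (xget 1 A) by apply: xgetPex; exists t; split=> //; exists x.
move=> Ju [y Iy tE]; apply: (J_conj_inj Ju Jt (genM (genV Ix) Iy)).
have -> : t = x^-1 * (x * t * x^-1) * x by gsimp.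
by rewrite {1}tE; gsimp.
Qed.

(** With x^-1 y = b d c, where b commutes with s and c with t, the product is
    conjugate under x b to s d t d^-1, whichever minimal d has been chosen. *)
Lemma frepP x y s t : gen I x -> gen I y -> J s -> J t ->
  let d := frep S I J (x * s * x^-1) (y * t * y^-1) in
  min_reps S I (comm s) (comm t) d /\
  exists g, (x * s * x^-1) * (y * t * y^-1) = g * (s * (d * t * d^-1)) * g^-1 /\
    (d = 1 -> s = t -> x * s * x^-1 = y * t * y^-1).
Proof.
move=> Ix Iy Js Jt /=; rewrite /frep !nuE //; set A := [set _ | _].
have [] : A (xget 1 A).
  apply: xgetPex.
  have [|e [b [c [hb hc ->]]] emin] := @ex_len_min (dcoset (comm s) (comm t) (x^-1 * y)).
    by exists (x^-1 * y), 1, 1; split; [exact: gen1|exact: gen1|gsimp].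
  have subI r z : gen (comm r) z -> gen I z by apply: genS; apply: comm_sub.
  exists (b * (x^-1 * y) * c); split; last first.
    exists x, y; split=> //; exists b^-1, c^-1; split; [exact: genV|exact: genV|by gsimp].
  split=> [|_ [b' [c' [hb' hc' ->]]]].
    by apply: genM (subI _ _ hc); apply: genM (subI _ _ hb) _; apply: genM Iy; apply: genV.
  apply: emin; exists (b' * b), (c * c'); split; [exact: genM|exact: genM|by gsimp].
move: (xget 1 A) => d hd [x' [y' [Ix' Iy' -> ->]]] [b [c [hb hc bdc]]].
split=> //; exists (x' * b).
have -> : y' = x' * b * d * c by rewrite -!mulgA (mulgA b) -bdc mulVKg.
have bs := gen_comm_commute hb; have ct := gen_comm_commute hc.
have cK : c * t * c^-1 = t by rewrite ct mulgK.
have bK : b * s * b^-1 = s by rewrite bs mulgK.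
split=> [|-> st].
  have -> : x' * b * d * c * t * (x' * b * d * c)^-1
    = x' * b * d * (c * t * c^-1) * d^-1 * b^-1 * x'^-1 by gsimp.
  by rewrite cK -{1}bK; gsimp.
have -> : x' * b * 1 * c * t * (x' * b * 1 * c)^-1
    = x' * (b * (c * t * c^-1) * b^-1) * x'^-1 by gsimp.
by rewrite cK -st bK.
Qed.

Lemma Jtilde_matrix : coxeter_matrix (Jtilde I J) (mtilde S I J).
Proof.
move=> _ _ [x [s [Ix Js ->]]] [y [t [Iy Jt ->]]].
have [hf [g [fE f1]]] := frepP Ix Iy Js Jt; rewrite /mtilde !nuE //.
move: (frep _ _ _ _ _) hf fE f1 => f hf fE f1.
have Ss := J_sub Js.
have [->|/eqP xy] := eqVneq; first by rewrite invol_conj ?eorder1 //; apply/cox_sq/J_sub.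
have infinite : (s <> t -> f <> 1) -> (s = t -> (1 < len S f)%N) ->
    eorder (s * (f * t * f^-1)) = None.
  move=> fneq feq; case: eorderP => // n n0 fn.
  by case: (infinite_order Js Jt hf fneq feq n0).
rewrite fE eorder_conj; have [st|/eqP st] := eqVneq s t.
  have [|fI] := boolP (f \in I).
    rewrite in_setE => If; rewrite -st (coxV (I_sub If)) -eorder_sq => [|n].
      by rewrite !mulgA.
    exact: mixed_even.
  apply: infinite => // _; rewrite ltnNge; apply/negP => lf.
  have [v [vI vf vs]] := gen_len_word I_sub hf.1.
  case: v vI vf vs => [|i [|? ?]]; last by move=> _ _ /= vs; rewrite -vs in lf.
    by rewrite wprod_nil => _ /esym/f1/(_ st).
  rewrite wprod_seq1 => /word_on_cons[Ii _] fi; case/negP: fI.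
  by rewrite in_setE -fi.
have [->|/eqP fn] := eqVneq f 1; first by gsimp.
by apply: infinite.
Qed.

Notation J' := (Jtilde I J).

Lemma Jtilde_reflection t : J' t -> reflections S t.
Proof. by move=> [x [s [_ Js ->]]]; apply/reflection_conj/reflection_gen/J_sub. Qed.

Lemma Jtilde_sq t : J' t -> t * t = 1.
Proof. by move=> /Jtilde_reflection/reflection_sq. Qed.

(** * Canonical generators *)

Definition I_parity v : bool := odd (count [pred x | x \in I] v).

Lemma I_parity_cat v w : I_parity (v ++ w) = I_parity v (+) I_parity w.
Proof. by rewrite /I_parity count_cat oddD. Qed.

Lemma I_parity_rev v : I_parity (rev v) = I_parity v.
Proof. by rewrite /I_parity count_rev. Qed.

Lemma mixed_even_sym s t n : I s -> J t -> (s * t) ^+ n = 1 -> ~~ odd n.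
Proof.
move=> Is Jt st; apply: (mixed_even Jt Is).
have -> : t * s = (s * t)^-1 by rewrite invgM (coxV (I_sub Is)) (coxV (J_sub Jt)).
by rewrite expVgn st invg1.
Qed.

Lemma I_memF x : J x -> (x \in I) = false.
Proof. by move=> Jx; apply/negP; rewrite in_setE => /notIJ; apply. Qed.

Lemma I_parity_pres (v w : seq (W * bool)) : pres_eq S (coxeter_relators S) v w ->
  I_parity (unzip1 v) = I_parity (unzip1 w).
Proof.
rewrite /unzip1; elim => {v w} [//|v w _ -> //|u v w _ -> _ -> //|u v x b Sx|u v r].
  by rewrite !map_cat !I_parity_cat /I_parity /= addn0 addnn odd_double.
move=> [s [t [n [Ss St]]]]; case: eorderP => // m m0 st _ [mn] ->.
rewrite -{n}mn; rewrite !map_cat !I_parity_cat -/(unzip1 (flatten _)) unzip1_relator.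
rewrite (_ : I_parity (alternating _ _ _) = false) ?addFb // /I_parity.
have -> : count [pred x | x \in I] (alternating (m + m) s t) = (m * ((s \in I) + (t \in I)))%N.
  by elim: m {m0 st} => [|m IH] //; rewrite addSn addnS /= IH addnA mulSn.
rewrite oddM; move: Ss St; rewrite hIJ => -[] hs [] ht.
- by rewrite !mem_set // andbF.
- by rewrite (negbTE (mixed_even_sym hs ht st)).
- by rewrite (negbTE (mixed_even hs ht st)).
- by rewrite !I_memF // andbF.
Qed.

Lemma I_parity_wprod v w : word_on S v -> word_on S w -> wprod v = wprod w ->
  I_parity v = I_parity w.
Proof.
move=> hv hw vw.
have hvw : word_on S (v ++ rev w) by apply/word_on_cat; split=> //; apply: word_on_rev.
have vw1 : wprod (v ++ rev w) = 1 by rewrite wprod_cat vw (wprod_rev cox_sq) // mulgV.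
have := I_parity_pres (cox_pres hvw vw1).
by rewrite unzip1_positive I_parity_cat I_parity_rev; case: (I_parity v); case: (I_parity w).
Qed.

(** The sign character that is -1 on I and 1 on J kills the subgroup generated
    by [J'], but no conjugate of an element of I. *)
Lemma gen_Jtilde_not_I r g i : gen J' r -> I i -> r <> g * i * g^-1.
Proof.
move=> Tr Ii rE.
have [v [vS vr vev]] : exists v, [/\ word_on S v, wprod v = r & ~~ I_parity v].
  move: r Tr {rE}; refine (gen_min _ _ _) => [|x y [v [vS <- vev]] [w [wS <- wev]]|].
  - by exists [::]; rewrite wprod_nil.
  - exists (v ++ rev w); rewrite wprod_cat (wprod_rev cox_sq) //; split=> //.
      by apply/word_on_cat; split=> //; apply: word_on_rev.
    by rewrite I_parity_cat I_parity_rev (negbTE vev).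
  - move=> _ [x [s [Ix Js ->]]].
    have [v vI <-] := gen_word (fun x Ix => cox_sq (I_sub Ix)) Ix.
    have vS : word_on S v by apply: sub_word_on I_sub vI.
    exists (v ++ s :: rev v); rewrite wprod_cat wprod_cons (wprod_rev cox_sq) // mulgA.
    split=> //.
      apply/word_on_cat; split=> //; apply/word_on_cons.
      by split; [apply: J_sub|apply: word_on_rev].
    rewrite I_parity_cat -cat1s I_parity_cat I_parity_rev addbCA addbb addbF.
    by rewrite /I_parity /= I_memF.
have [w wS wg] := cox_word g.
have wiS : word_on S (w ++ i :: rev w).
  apply/word_on_cat; split=> //; apply/word_on_cons.
  by split; [apply: I_sub|apply: word_on_rev].
have := I_parity_wprod vS wiS; rewrite wprod_cat wprod_cons (wprod_rev cox_sq) // mulgA.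
rewrite vr wg -rE => /(_ erefl) h; move: vev; rewrite h.
rewrite I_parity_cat -cat1s I_parity_cat I_parity_rev addbCA addbb addbF.
by rewrite /I_parity /= mem_set.
Qed.

(** The inversions of x s x^-1 contributed by x and x^-1 are conjugate to elements
    of I, hence outside of the subgroup generated by [J']. *)
Lemma eta_Jtilde t r : J' t -> gen J' r -> eta t r = (r == t).
Proof.
move=> Tt Tr; apply/idP/eqP => [|->]; last exact/eta_refl/Jtilde_reflection.
case: Tt => x [s [Ix Js ->]]; rewrite !etaM.
have -> : eta x r = false.
  by apply/negP => /(eta_gen_I Ix)[g [i [Ii]]]; apply: gen_Jtilde_not_I.
rewrite [X in _ (+) X](_ : _ = false) ?addbF ?addFb => [|].
  by rewrite eta_gen; [move/eqP => <-; gsimp|apply: J_sub].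
apply/negP => /(eta_gen_I (genV Ix))[g [i [Ii rE]]].
apply: (gen_Jtilde_not_I (g := x * s * g) Tr Ii).
have -> : r = x * s * ((x * s)^-1 * r * (x * s)) * (x * s)^-1 by gsimp.
by rewrite rE; gsimp.
Qed.

(** t being an involution, its right inversions are its left inversions. *)
Lemma Nset_reflection t r : reflections S t ->
  Nset S t r <-> reflections S r /\ eta t r.
Proof.
move=> ht; have tV : t^-1 = t by apply/mulg1_eq/reflection_sq.
have rt : reflections S r -> len S (t * r) = len S (r * t).
  by move=> hr; rewrite -lenV invgM tV (mulg1_eq (reflection_sq hr)).
by split=> -[hr h]; split=> //; move: h; rewrite eta_len // rt.
Qed.

(** On the subgroup generated by [J'], the inversions of a product of elements of
    [J'] are given by the same parity rule as for words in [S]. *)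
Lemma eta_Jtilde_word v r : word_on J' v -> gen J' r -> eta (wprod v) r = rpar v r.
Proof.
elim: v r => [|x v IH] r; first by rewrite wprod_nil eta1.
move=> /word_on_cons[Tx Tv] Tr; rewrite wprod_cons etaM eta_Jtilde //= IH //.
exact: (genM (genM (genV (gen_sub Tx)) Tr) (gen_sub Tx)).
Qed.

(** An element t of chi is equal to the first factor x of a shortest expression of
    t in [J']: if x were not an inversion of t, it would be one of the product of
    the other factors, and exchanging it would shorten the expression. *)
Lemma Jtilde_chi : J' = chi S (gen J').
Proof.
apply/seteqP; split=> t.
  move=> Tt; have ht := Jtilde_reflection Tt; split=> //.
  apply/seteqP; split=> r /=.
    by move=> [/(Nset_reflection _ ht)[_ tr] Tr]; apply/eqP; rewrite -eta_Jtilde.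
  move=> ->; split; last exact: gen_sub.
  by apply/Nset_reflection => //; split=> //; apply: eta_refl.
move=> [ht /seteqP[sub /(_ t erefl)[_ Tt]]].
have : exists n, `[< exists2 v, word_on J' v /\ wprod v = t & size v = n >].
  by have [v Tv vt] := gen_word Jtilde_sq Tt; exists (size v); apply/asboolP; exists v.
move=> /ex_minnP[n /asboolP[[|x v] [Tv vt] vn] nmin].
  by move: vt; rewrite wprod_nil => t1; case: (reflection_neq1 ht).
have [Tx Tv'] := (word_on_cons _ _ _).1 Tv; suff -> : t = x by [].
apply/esym/sub; split; last exact: gen_sub.
apply/Nset_reflection => //; split; first exact: Jtilde_reflection.
rewrite -vt eta_Jtilde_word //=; last exact: gen_sub.
rewrite eqxx /= mulVg mul1g; apply/negP.
move=> /(rpar_delete (fun y yv => Jtilde_sq (Tv' y yv)))[a [y [b [vE xv]]]].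
have Tab : word_on J' (a ++ b).
  by move: Tv'; rewrite vE => /word_on_cat[Ta /word_on_cons[_ Tb]]; apply/word_on_cat.
have : (n <= size (a ++ b))%N.
  by apply: nmin; apply/asboolP; exists (a ++ b); rewrite // -xv -wprod_cons.
by rewrite -vn /= vE !size_cat /= addnS ltnNge leqnSn.
Qed.

(** * Reidemeister-Schreier rewriting *)

(** Reading a word in [S], [position] multiplies up its letters in I from the
    starting point p, and [emit] outputs x s x^-1 for each letter s in J that is
    read at position x. This is the Reidemeister-Schreier rewriting for the
    retraction onto W_I that kills J. *)
Fixpoint position p (w : seq (W * bool)) : W :=
  if w is a :: w' then position (if a.1 \in I then p * a.1 else p) w' else p.

Fixpoint emit p (w : seq (W * bool)) : seq (W * bool) :=
  if w is a :: w' then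
    if a.1 \in I then emit (p * a.1) w'
    else if a.1 \in J then (p * a.1 * p^-1, a.2) :: emit p w' else emit p w'
  else [::].

Lemma position_cat p (u v : seq (W * bool)) : position p (u ++ v) = position (position p u) v.
Proof. by elim: u p => //= a u IH p. Qed.

Lemma emit_cat p (u v : seq (W * bool)) : emit p (u ++ v) = emit p u ++ emit (position p u) v.
Proof.
elim: u p => //= a u IH p; rewrite !IH; case: ifP => // _.
by case: ifP => // _.
Qed.

Lemma gen_position p (u : seq (W * bool)) : gen I p -> gen I (position p u).
Proof.
elim: u p => //= a u IH p Ip; apply: IH; case: ifP => //; rewrite in_setE.
by move=> /gen_sub; apply: genM.
Qed.

Lemma emit_positive p v : word_on I v -> emit p (positive v) = [::].
Proof.
elim: v p => //= x v IH p /word_on_cons[Ix Iv].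
by rewrite (mem_set Ix); apply: IH.
Qed.

Lemma position_positive p v : word_on I v -> position p (positive v) = p * wprod v.
Proof.
elim: v p => [|x v IH] p /=; first by rewrite wprod_nil mulg1.
by move=> /word_on_cons[Ix Iv]; rewrite (mem_set Ix) IH // wprod_cons mulgA.
Qed.

Lemma Jtilde_conj p s : gen I p -> J s -> J' (p * s * p^-1).
Proof. by move=> Ip Js; exists p, s. Qed.

(** In the mixed case s in J and t in I, the order is some 2k and the output at p is
    the k-th power of the word in p s p^-1 and p t s t p^-1, whose product is
    conjugate to (st)^2 and so has order k. The case s in I, t in J is similar. *)
Lemma emit_relator p s t n : gen I p -> S s -> S t -> eorder (s * t) = Some n ->
  let r := flatten (nseq n [:: (s, true); (t, true)]) in
  position p r = p /\ pres_eq J' (coxeter_relators J') (emit p r) [::].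
Proof.
move=> Ip Ss St st /=; have [_ stn] : (0 < n)%N /\ (s * t) ^+ n = 1.
  by case: eorderP st => // m m0 mn _ [<-].
have repeat (q : seq (W * bool)) (e : seq (W * bool)) k :
    position p q = p -> emit p q = e ->
    position p (flatten (nseq k q)) = p /\ emit p (flatten (nseq k q)) = flatten (nseq k e).
  move=> pq eq; elim: k => //= k [IH1 IH2].
  by rewrite position_cat emit_cat pq eq IH1 IH2.
have half_relator k : flatten (nseq k.*2 [:: (s, true); (t, true)]) =
    flatten (nseq k [:: (s, true); (t, true); (s, true); (t, true)]).
  by elim: k => //= k ->.
move: (Ss) (St); rewrite hIJ => -[] hs [] ht.
- have -> : flatten (nseq n [:: (s, true); (t, true)]) = positive (alternating (n + n) s t).
    by elim: n {st stn} => //= n ->; rewrite addnS.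
  have stI : word_on I (alternating (n + n) s t).
    by apply: sub_word_on (@alternating_word_on _ s t _) => _ [] ->.
  rewrite position_positive // emit_positive // wprod_alternating stn mulg1.
  by split=> //; apply: pres_refl.
- have nE : n = n./2.*2 by rewrite even_halfK // (mixed_even_sym hs ht stn).
  have hsq : eorder (s * t * (s * t)) = Some n./2.
    by rewrite eorder_sq ?st // => k; apply: mixed_even_sym.
  rewrite nE half_relator.
  have [||-> ->] := repeat [:: (s, true); (t, true); (s, true); (t, true)]
     [:: (p * s * t * (p * s)^-1, true); (p * t * p^-1, true)] n./2.
  + by rewrite /= (mem_set hs) (I_memF ht) -mulgA cox_sq // mulg1.
  + by rewrite /= (mem_set hs) (I_memF ht) (mem_set ht) -(mulgA p s s) cox_sq // mulg1.
  split=> //; apply: coxeter_relator_pres; [|exact: Jtilde_conj|].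
    by apply: Jtilde_conj => //; apply: genM (gen_sub hs).
  rewrite -hsq -[RHS](eorder_conj p); congr eorder; gsimp.
  by rewrite (coxV Ss).
- have nE : n = n./2.*2 by rewrite even_halfK // (mixed_even hs ht stn).
  have hsq : eorder (s * t * (s * t)) = Some n./2.
    by rewrite eorder_sq ?st // => k; apply: mixed_even.
  rewrite nE half_relator.
  have [||-> ->] := repeat [:: (s, true); (t, true); (s, true); (t, true)]
     [:: (p * s * p^-1, true); (p * t * s * (p * t)^-1, true)] n./2.
  + by rewrite /= (mem_set ht) (I_memF hs) -mulgA cox_sq // mulg1.
  + by rewrite /= (I_memF hs) (mem_set hs) (mem_set ht).
  split=> //; apply: coxeter_relator_pres; [exact: Jtilde_conj| |].
    by apply: Jtilde_conj => //; apply: genM (gen_sub ht).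
  rewrite -hsq -[RHS](eorder_conj p); congr eorder; gsimp.
  by rewrite (coxV St).
- have [||-> ->] := repeat [:: (s, true); (t, true)]
     [:: (p * s * p^-1, true); (p * t * p^-1, true)] n.
  + by rewrite /= !I_memF.
  + by rewrite /= !I_memF // !mem_set.
  split=> //; apply: coxeter_relator_pres; try exact: Jtilde_conj.
  by rewrite -st -[RHS](eorder_conj p); congr eorder; gsimp.
Qed.

Lemma emit_pres (v w : seq (W * bool)) : pres_eq S (coxeter_relators S) v w -> forall p, gen I p ->
  position p v = position p w /\ pres_eq J' (coxeter_relators J') (emit p v) (emit p w).
Proof.
elim=> {v w} [w|v w _ IH|u v w _ IH1 _ IH2|u v x b Sx|u v r [s [t [n [Ss St st ->]]]]] p0.
- by move=> _; split=> //; apply: pres_refl.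
- by move=> /IH[-> h]; split=> //; apply: pres_sym.
- move=> Ip; have [-> h1] := IH1 _ Ip; have [-> h2] := IH2 _ Ip.
  by split=> //; apply: pres_trans h1 h2.
- move=> /(gen_position u); rewrite !position_cat !emit_cat.
  move: (position _ u) (emit _ u) => p e Ip /=.
  move: (Sx); rewrite hIJ => -[] hx.
    by rewrite (mem_set hx) -!mulgA cox_sq // mulg1; split=> //; apply: pres_refl.
  rewrite (I_memF hx) (mem_set hx); split=> //.
  exact: (pres_cancel _ e (emit p v) b (Jtilde_conj Ip hx)).
move=> /(gen_position u); rewrite !position_cat !emit_cat.
move: (position _ u) (emit _ u) => p e Ip.
have [-> h] := emit_relator Ip Ss St st; split=> //.
exact: pres_eq_cat h.
Qed.

(** A letter x s x^-1 is lifted to a word for x, the letter s and the reversed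
    word: read from 1, only s is output, at position x. *)
Lemma lift_Jtilde (w : seq (W * bool)) : (forall a, a \in w -> J' a.1) ->
  exists v : seq (W * bool), [/\ forall a, a \in v -> S a.1, word_eval v = word_eval w
    & emit 1 v = w].
Proof.
elim: w => [_|[t b] w IH Tw]; first by exists [::].
have [a aw|v [vS vw ve]] := IH; first by apply: Tw; rewrite inE aw orbT.
have [x [s [Ix Js tE]]] : J' t by apply: (Tw (t, b)); rewrite inE eqxx.
have [u uI ux] := gen_word (fun x Ix => cox_sq (I_sub Ix)) Ix.
have uI' : word_on I (rev u) by apply: word_on_rev.
have uxV : wprod (rev u) = x^-1 by rewrite (wprod_rev (X := I)) ?ux // => y /I_sub/cox_sq.
exists (positive u ++ (s, b) :: positive (rev u) ++ v); split.
- move=> a; rewrite mem_cat inE mem_cat => /or4P[/mapP[y /uI/I_sub Sy ->//]| | |/vS//].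
    by move=> /eqP->; apply: J_sub.
  by move=> /mapP[y /uI'/I_sub Sy ->].
- rewrite word_eval_cat !word_eval_cons word_eval_cat !word_eval_positive vw ux uxV tE.
  by case: b {Tw}; rewrite /letter /=; gsimp.
- rewrite emit_cat /= (I_memF Js) (mem_set Js) emit_cat !emit_positive // !position_positive //.
  by rewrite ux uxV mul1g mulgV ve -tE.
Qed.

Lemma Jtilde_coxeter : coxeter_system (gen J') J'.
Proof.
split=> [t Tt|].
  by apply/eorder2; split; [apply: Jtilde_sq|apply/reflection_neq1/Jtilde_reflection].
split=> // w Tw; split=> [w1|/pres_word_eval->]; last exact: word_eval_nil.
have [v [vS vw ve]] := lift_Jtilde Tw.
have v1 : pres_eq S (coxeter_relators S) v [::] by apply/(hS.2.2 _ vS).1; rewrite vw.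
by have [_] := emit_pres v1 (gen1 I); rewrite ve.
Qed.

End Partition.

End Coxeter.

Theorem theorem3p6 (W : groupType) (S I J : set W)
    (hS : coxeter_system [set: W] S)
    (hIJ : S = I `|` J) (hdisj : I `&` J = set0)
    (hconj : forall s t w : W, I s -> J t -> w * s * w^-1 <> t) :
  [/\ coxeter_system (gen (Jtilde I J)) (Jtilde I J),
      coxeter_matrix (Jtilde I J) (mtilde S I J)
    & Jtilde I J = chi S (gen (Jtilde I J))].
Proof.
split; first exact: (Jtilde_coxeter hS).
- exact: (Jtilde_matrix hS).
- exact: (Jtilde_chi hS).
Qed.
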